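(* Let $H$ be a Hadamard manifold, $E\subseteq H$ a nonempty open geodesic convex set, $\phi_s:E\to\mathbb{I}$, $\phi_s(p)=[\phi_s^L(p),\phi_s^U(p)]$, $s\in\{1,\dots,l\}$, interval-valued functions, $\psi_u:E\to\mathbb{R}$, $u\in\{1,\dots,t\}$, real-valued functions, $F=\{p\in E:\psi_u(p)\le 0,\ u=1,\dots,t\}$, and consider the problem (MIVOP2) of minimizing $\phi=(\phi_1,\dots,\phi_l)$ over $F$. Let $\bar p\in F$ and let each $\psi_u$ be convex and directionally differentiable at $\bar p$. (a) Suppose that the $\phi_s$, $s\in\{1,\dots,l\}$, are LU-convex and weakly directionally differentiable at $\bar p$ and that there exist real numbers $\lambda_s^L>0,\ \lambda_s^U>0$, $s\in\{1,\dots,l\}$, and $\mu_u\ge 0$, $u\in\{1,\dots,t\}$, such that (i) $\sum_{s=1}^{l}\lambda_s^L(\phi_s^L)'(\bar p;\exp_{\bar p}^{-1}p)+\sum_{s=1}^{l}\lambda_s^U(\phi_s^U)'(\bar p;\exp_{\bar p}^{-1}p)+\sum_{u=1}^{t}\mu_u\psi_u'(\bar p;\exp_{\bar p}^{-1}p)\ge 0$ for all $p\in F$; (ii) $\mu_u\psi_u(\bar p)=0$ for $u\in\{1,\dots,t\}$. Then $\bar p$ is a type-I Pareto optimal solution of (MIVOP2). (b) Suppose that the $\phi_s$, $s\in\{1,\dots,l\}$, are CW-convex and weakly directionally differentiable at $\bar p$ and that there exist real numbers $\lambda_s^C>0,\ \lambda_s^W>0$, $s\in\{1,\dots,l\}$,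 and $\mu_u\ge 0$, $u\in\{1,\dots,t\}$, such that (iii) $\sum_{s=1}^{l}\lambda_s^C(\phi_s^C)'(\bar p;\exp_{\bar p}^{-1}p)+\sum_{s=1}^{l}\lambda_s^W(\phi_s^W)'(\bar p;\exp_{\bar p}^{-1}p)+\sum_{u=1}^{t}\mu_u\psi_u'(\bar p;\exp_{\bar p}^{-1}p)\ge 0$ for all $p\in F$; (iv) $\mu_u\psi_u(\bar p)=0$ for $u\in\{1,\dots,t\}$. Then $\bar p$ is a type-II Pareto optimal solution of (MIVOP2). (c) Suppose that the $\phi_s$, $s\in\{1,\dots,l\}$, are CW-convex and weakly directionally differentiable at $\bar p$ and that there exist real numbers $\lambda_s^L>0,\ \lambda_s^U>0$, $s\in\{1,\dots,l\}$, and $\mu_u\ge 0$, $u\in\{1,\dots,t\}$, such that (v) $\lambda_s^L<\lambda_s^U$ for $s\in\{1,\dots,l\}$; (vi) $\sum_{s=1}^{l}\lambda_s^L(\phi_s^L)'(\bar p;\exp_{\bar p}^{-1}p)+\sum_{s=1}^{l}\lambda_s^U(\phi_s^U)'(\bar p;\exp_{\bar p}^{-1}p)+\sum_{u=1}^{t}\mu_u\psi_u'(\bar p;\exp_{\bar p}^{-1}p)\ge 0$ for all $p\in F$; (vii) $\mu_u\psi_u(\bar p)=0$ for $u\in\{1,\dots,t\}$. Then $\bar p$ is a type-II Pareto optimal solution of (MIVOP2).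
   Context: A Hadamard manifold $H$ is a complete simply connected Riemannian manifold of non-positive sectional curvature; for $p\in H$ the map $\exp_p:T_p(H)\to H$ is a diffeomorphism with inverse $\exp_p^{-1}$, and the geodesic joining $p$ to $q$ is $\gamma_{p,q}(\alpha)=\exp_p(\alpha\exp_p^{-1}q)$, $\alpha\in[0,1]$. A set $E\subseteq H$ is geodesic convex if $\gamma_{p,q}(\alpha)\in E$ for all $p,q\in E$, $\alpha\in[0,1]$. The feasible set $F$ is assumed geodesic convex. For $f:E\to\mathbb{R}$, the directional derivative is $f'(p;w)=\lim_{\alpha\to0^+}\frac{f(\exp_p(\alpha w))-f(p)}{\alpha}$, $w\in T_p(H)$; $f$ is directionally differentiable at $p$ if it exists (finite) for all $w\in T_p(H)$. $f$ is convex at $p\in E$ if $f(\gamma_{p,q}(\alpha))\le\alpha f(q)+(1-\alpha)f(p)$ for all $q\in E$, $\alpha\in[0,1]$. $\mathbb{I}$ is the set of closed bounded intervals of $\mathbb{R}$. For $T=[t^L,t^U]$, $S=[s^L,s^U]$: $T+S=[t^L+s^L,t^U+s^U]$, and $kT=[kt^L,kt^U]$ for $k\ge0$; $t^C=\frac12(t^L+t^U)$ and $t^W=\frac12(t^U-t^L)$. $T\leqq_{LU}S$ iff $t^L\le s^L$ and $t^U\le s^U$; $T\leqq_{CW}S$ iff $t^C\le s^C$ and $t^W\le s^W$; for either order, $T<S$ means $T\leqq S$ and $T\ne S$. For tuples $(T_1,\dots,T_l)$, $(S_1,\dots,S_l)$ of intervals and either order, $T\leqq S$ means $T_k\leqq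 S_k$ for all $k$, and $T<S$ means $T_k\leqq S_k$ for all $k$ and $T_h<S_h$ for at least one $h$. For $f=[f^L,f^U]:E\to\mathbb{I}$ put $f^C=\frac12(f^L+f^U)$, $f^W=\frac12(f^U-f^L)$. $f$ is weakly directionally differentiable at $p$ if $f^L$ and $f^U$ are directionally differentiable at $p$. $f$ is LU-convex (resp. CW-convex) at $p$ if for all $q\in E$, $\alpha\in[0,1]$: $f(\gamma_{p,q}(\alpha))\leqq_{LU}(1-\alpha)f(p)+\alpha f(q)$ (resp. with $\leqq_{CW}$). $\bar p\in F$ is a type-I (resp. type-II) Pareto optimal solution of (MIVOP2) if there is no $\hat p\in F$ with $\phi(\hat p)<_{LU}\phi(\bar p)$ (resp. $\phi(\hat p)<_{CW}\phi(\bar p)$). *)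

(* Defs.v *)
From HB Require Import structures.
From mathcomp Require Import all_boot all_order all_algebra.
From mathcomp Require Import all_classical all_reals all_analysis.

Set Implicit Arguments.
Unset Strict Implicit.
Unset Printing Implicit Defensive.

Import Order.TTheory GRing.Theory Num.Theory.
Import numFieldNormedType.Exports.

Local Open Scope classical_set_scope.
Local Open Scope ring_scope.

Section Smooth.
Context {R : realType} {n : nat} {V : normedModType R}.

Definition partial (i : 'I_n) (f : 'rV[R]_n -> V) : 'rV[R]_n -> V :=
  fun x => 'D_(delta_mx 0 i) f x.

Definition iter_partial (s : seq 'I_n) (f : 'rV[R]_n -> V) : 'rV[R]_n -> V :=
  foldr partial f s.

(* Meant for U open: the partial derivatives of all orders exist and are
   continuous on U. *)
Definition smooth_on (U : set 'rV[R]_n) (f : 'rV[R]_n -> V) : Prop :=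
  forall (s : seq 'I_n) (x : 'rV[R]_n), U x ->
    {for x, continuous (iter_partial s f)} /\
    forall i : 'I_n, derivable (iter_partial s f) x (delta_mx 0 i).

End Smooth.

(* The atlas consists of one chosen chart around each point: [chart c] is a chart
   with domain [chart_dom c], a neighbourhood of [c], and [chart_inv c] is its
   inverse. Outside [chart_dom c] and its image these functions are irrelevant.
   The charts [chart c] generate the smooth structure. *)
Record smooth_manifold (R : realType) (n : nat) := SmoothManifold {
  carrier :> topologicalType;
  chart_dom : carrier -> set carrier;
  chart : carrier -> carrier -> 'rV[R]_n;
  chart_inv : carrier -> 'rV[R]_n -> carrier;
  manifold_hausdorff : hausdorff_space carrier;
  manifold_second_countable : @second_countable carrier;
  chart_dom_center : forall c, chart_dom c c;
  chart_dom_open : forall c, open (chart_dom c);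
  chart_im_open : forall c, open (chart c @` chart_dom c);
  chartK : forall c, {in chart_dom c, cancel (chart c) (chart_inv c)};
  chart_continuous : forall c x, chart_dom c x ->
    {for x, continuous (chart c)};
  chart_inv_continuous : forall c x, chart_dom c x ->
    {for chart c x, continuous (chart_inv c)};
  chart_smooth : forall c d,
    smooth_on (chart c @` (chart_dom c `&` chart_dom d))
              (chart d \o chart_inv c)
}.

(* The tangent space at p is 'rV[R]_n: a tangent vector is represented by its
   coordinates in the chart [chart p] chosen at p. *)
Definition tangent (R : realType) (n : nat) (M : smooth_manifold R n)
  (p : M) : lmodType R := 'rV[R]_n.

(* Matrix, in the coordinates of [chart c], of a field of bilinear forms
   [g q] on the tangent spaces; the Jacobian matrices act on row vectors. *)
Definition metric_in (R : realType) (n : nat) (M : smooth_manifold R n)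
    (g : M -> 'M[R]_n) (c : M) (x : 'rV[R]_n) : 'M[R]_n :=
  let q := chart_inv c x in
  let J := jacobian (chart q \o chart_inv c) x in
  J *m g q *m J^T.

Record riemannian_manifold (R : realType) (n : nat) := RiemannianManifold {
  underlying :> smooth_manifold R n;
  metric : underlying -> 'M[R]_n;
  metric_sym : forall p, (metric p)^T = metric p;
  metric_pos : forall p (v : 'rV[R]_n), v != 0 ->
    0 < (v *m metric p *m v^T) 0 0;
  metric_smooth : forall c (i j : 'I_n),
    smooth_on (chart c @` chart_dom c)
              (fun x => metric_in metric c x i j : R^o)
}.

Section Riemannian.
Context {R : realType} {n : nat} (M : riemannian_manifold R n).

Definition inner (p : M) (u v : tangent p) : R :=
  ((u : 'rV[R]_n) *m metric p *m (v : 'rV[R]_n)^T) 0 0.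

Definition gcoef (c : M) (i j : 'I_n) (x : 'rV[R]_n) : R^o :=
  metric_in (@metric R n M) c x i j.

(* [christoffel c k i j] is the coefficient Gamma^k_(i j) of the Levi-Civita
   connection in the coordinates of [chart c]. *)
Definition christoffel (c : M) (k i j : 'I_n) (x : 'rV[R]_n) : R^o :=
  2^-1 * \sum_(l < n)
    invmx (metric_in (@metric R n M) c x) k l *
    (partial i (gcoef c j l) x + partial j (gcoef c i l) x
     - partial l (gcoef c i j) x).

(* [riemann c l i j k] is the coefficient of d_l in R(d_i, d_j) d_k, where
   R(X, Y) Z = D_X D_Y Z - D_Y D_X Z - D_[X, Y] Z. *)
Definition riemann (c : M) (l i j k : 'I_n) (x : 'rV[R]_n) : R :=
  partial i (christoffel c l j k) x - partial j (christoffel c l i k) x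
  + \sum_(m < n) (christoffel c m j k x * christoffel c l i m x
                  - christoffel c m i k x * christoffel c l j m x).

Definition curvature (p : M) (u v w : 'rV[R]_n) : tangent p :=
  \row_(l < n) \sum_(i < n) \sum_(j < n) \sum_(k < n)
    riemann p l i j k (chart p p) * u 0 i * v 0 j * w 0 k.

Definition sectional_curvature (p : M) (u v : 'rV[R]_n) : R :=
  @inner p (curvature p u v v) u /
  (@inner p u u * @inner p v v - @inner p u v ^+ 2).

Definition nonpositive_curvature : Prop :=
  forall (p : M) (u v : 'rV[R]_n),
    row_free (col_mx u v) -> sectional_curvature p u v <= 0.

Definition geodesic (y : R -> M) : Prop :=
  continuous y /\
  forall (t : R) (c : M), chart_dom c (y t) ->
    let x : R -> 'rV[R]_n := chart c \o y in
    let x' := derive1 x in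
    [/\ \forall s \near t, derivable x s 1,
        derivable x' t 1 &
        forall k : 'I_n,
          derive1 x' t 0 k
          + \sum_(i < n) \sum_(j < n)
              christoffel c k i j (x t) * x' t 0 i * x' t 0 j = 0].

Definition geodesic_from (p : M) (v : tangent p) (y : R -> M) : Prop :=
  [/\ geodesic y, y 0 = p & derive1 (chart p \o y) 0 = (v : 'rV[R]_n)].

(* Geodesic completeness: every initial velocity is that of a geodesic defined
   on the whole real line. *)
Definition complete_manifold : Prop :=
  forall (p : M) (v : tangent p), exists y : R -> M, geodesic_from v y.

End Riemannian.

(* Path connected, and every loop is homotopic to a constant loop relatively to
   its base point. *)
Definition simply_connected (R : realType) (T : topologicalType) : Prop :=
  (forall x y : T, exists2 h : R -> T,
     {within `[0, 1], continuous h} & h 0 = x /\ h 1 = y) /\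
  (forall h : R -> T, {within `[0, 1], continuous h} -> h 0 = h 1 ->
     exists2 K : R * R -> T,
       {within `[0, 1] `*` `[0, 1], continuous K} &
       [/\ forall t, t \in `[0, 1] -> K (0, t) = h t,
           forall t, t \in `[0, 1] -> K (1, t) = h 0 &
           forall s, s \in `[0, 1] -> K (s, 0) = h 0 /\ K (s, 1) = h 0]).

Record hadamard_manifold (R : realType) (n : nat) := HadamardManifold {
  hadamard_riemannian :> riemannian_manifold R n;
  hadamard_complete : complete_manifold hadamard_riemannian;
  hadamard_simply_connected : simply_connected R hadamard_riemannian;
  hadamard_nonpositive : nonpositive_curvature hadamard_riemannian
}.

Section Hadamard.
Context {R : realType} {n : nat} (H : hadamard_manifold R n).

(* The geodesic issued from p with velocity v exists by completeness and is
   unique; [exp_map p v] is its value at time 1. *)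
Definition exp_map (p : H) (v : tangent p) : H :=
  xget p [set q | exists2 y : R -> H, geodesic_from v y & y 1 = q].

(* By the Cartan-Hadamard theorem [exp_map p] is a bijection; this is its
   inverse. *)
Definition exp_inv (p q : H) : tangent p :=
  xget 0 [set v | exp_map v = q].

Definition geodesic_seg (p q : H) (a : R) : H := exp_map (a *: exp_inv p q).

Definition geodesic_convex (E : set H) : Prop :=
  forall p q, E p -> E q -> forall a : R, 0 <= a <= 1 -> E (geodesic_seg p q a).

(* Functions on an open set E are represented by functions on H; only their
   values on E matter: for p in E and a > 0 small, exp_p (a w) lies in E. *)
Definition dir_quotient (f : H -> R) (p : H) (w : tangent p) (a : R) : R :=
  (f (exp_map (a *: w)) - f p) / a.

Definition dir_deriv (f : H -> R) (p : H) (w : tangent p) : R :=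
  lim (dir_quotient f w a @[a --> 0^'+]).

Definition dir_differentiable (f : H -> R) (p : H) : Prop :=
  forall w : tangent p, cvg (dir_quotient f w a @[a --> 0^'+]).

Definition convex_at (E : set H) (f : H -> R) (p : H) : Prop :=
  forall q, E q -> forall a : R, 0 <= a <= 1 ->
    f (geodesic_seg p q a) <= a * f q + (1 - a) * f p.

End Hadamard.

Record cb_interval (R : realType) := CBInterval {
  lo : R;
  hi : R;
  lo_le_hi : lo <= hi
}.

Section Intervals.
Context {R : realType}.
Implicit Types T S : cb_interval R.

Fact cbi_add_subproof T S : lo T + lo S <= hi T + hi S.
Proof. by apply: lerD; apply: lo_le_hi. Qed.

Definition cbi_add T S : cb_interval R := CBInterval (cbi_add_subproof T S).

Fact cbi_scale_subproof (k : R) (k0 : 0 <= k) T : k * lo T <= k * hi T.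
Proof. by apply: ler_wpM2l => //; apply: lo_le_hi. Qed.

Definition cbi_scale (k : R) (k0 : 0 <= k) T : cb_interval R :=
  CBInterval (cbi_scale_subproof k0 T).

Definition cbi_center T : R := 2^-1 * (lo T + hi T).
Definition cbi_halfwidth T : R := 2^-1 * (hi T - lo T).

Definition le_LU T S : Prop := lo T <= lo S /\ hi T <= hi S.
Definition le_CW T S : Prop :=
  cbi_center T <= cbi_center S /\ cbi_halfwidth T <= cbi_halfwidth S.

Definition strict_order (le : cb_interval R -> cb_interval R -> Prop) T S :
  Prop := le T S /\ T <> S.

Definition tuple_lt (le : cb_interval R -> cb_interval R -> Prop) (l : nat)
    (T S : 'I_l -> cb_interval R) : Prop :=
  (forall k, le (T k) (S k)) /\ exists h, strict_order le (T h) (S h).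

End Intervals.

Section IntervalValued.
Context {R : realType} {n : nat} (H : hadamard_manifold R n).
Implicit Types (f : H -> cb_interval R) (p : H).

Definition fL f : H -> R := fun p => lo (f p).
Definition fU f : H -> R := fun p => hi (f p).
Definition fC f : H -> R := fun p => 2^-1 * (fL f p + fU f p).
Definition fW f : H -> R := fun p => 2^-1 * (fU f p - fL f p).

Definition weakly_dir_differentiable f p : Prop :=
  dir_differentiable (fL f) p /\ dir_differentiable (fU f) p.

Definition interval_convex_at (le : cb_interval R -> cb_interval R -> Prop)
    (E : set H) f p : Prop :=
  forall q, E q -> forall (a : R) (a0 : 0 <= a) (a1 : 0 <= 1 - a),
    le (f (geodesic_seg p q a))
       (cbi_add (cbi_scale a1 (f p)) (cbi_scale a0 (f q))).

Definition LU_convex_at := interval_convex_at le_LU.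
Definition CW_convex_at := interval_convex_at le_CW.

Definition feasible (E : set H) (t : nat) (psi : 'I_t -> H -> R) : set H :=
  [set p | E p /\ forall u, psi u p <= 0].

Definition pareto_optimal (le : cb_interval R -> cb_interval R -> Prop)
    (F : set H) (l : nat) (phi : 'I_l -> H -> cb_interval R) (p : H) : Prop :=
  F p /\ ~ exists q, F q /\ tuple_lt le (fun s => phi s q) (fun s => phi s p).

Definition type_I_pareto := pareto_optimal le_LU.
Definition type_II_pareto := pareto_optimal le_CW.

End IntervalValued.

(* Main.v *)
Require Import Defs.
From mathcomp Require Import all_boot all_order all_algebra.
From mathcomp Require Import all_classical all_reals all_analysis.
From mathcomp Require Import ring lra.

Import Order.TTheory GRing.Theory Num.Theory.
Import numFieldNormedType.Exports.

Local Open Scope classical_set_scope.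
Local Open Scope ring_scope.

(** A function that is convex at [pbar] lies above its first-order model there:
    its directional derivative along [exp_inv pbar q] is at most
    [f q - f pbar] ([dir_deriv_le_of_convex]). The geodesic from [pbar] to [q]
    is by definition [a |-> exp_map (a *: exp_inv pbar q)], so this is convexity
    divided by [a], then [a --> 0^'+]: the argument stays on one geodesic and
    the curvature never enters.

    Suppose now that a feasible [q] dominates [pbar]. In the multiplier
    condition at [q], replace each derivative by the corresponding increment.
    Each objective increment is at most 0 by domination, and each constraint
    term is at most [mu u * psi u q <= 0] by complementary slackness. Hence a
    sum of nonpositive terms is nonnegative and all the terms vanish; since the
    objective weights are positive, [q] and [pbar] have the same objective
    values ([multiplier_rule_no_descent]), which contradicts strict domination.

    For the LU order this is applied to the endpoint functions. For the CW order
    it is applied to the center and half-width functions, whose derivatives are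
    combinations of those of the endpoints. The mixed case, endpoint multipliers
    with CW-convexity, reduces to the latter by
    [lL * L + lU * U = (lL + lU) * C + (lU - lL) * W]
    for an interval with endpoints [L], [U], center [C] and half-width [W]; the
    condition [lL < lU] is what makes the weight of [W] positive. *)

(** * Directional derivatives *)

Section DirectionalDerivative.
Context {R : realType} {n : nat} {H : hadamard_manifold R n}.
Implicit Types (f g : H -> R) (p q : H) (c d : R).

Lemma dir_deriv_le_of_convex (E : set H) f p q :
  convex_at E f p -> dir_differentiable f p -> E q ->
  dir_deriv f (exp_inv p q) <= f q - f p.
Proof.
move=> fconv fdiff Eq; apply: limr_le; first exact: fdiff.
near=> a.
have a_gt0 : 0 < a by near: a; exact: nbhs_right_gt.
have a_le1 : a <= 1 by near: a; apply: nbhs_right_le.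
have a01 : 0 <= a <= 1 by rewrite ltW.
have := fconv q Eq a a01.
rewrite /dir_quotient /geodesic_seg ler_pdivrMr// => fa.
lra.
Unshelve. all: by end_near.
Qed.

Lemma cvg_dir_quotient_lincomb f g c d p (w : tangent p) :
  dir_differentiable f p -> dir_differentiable g p ->
  dir_quotient (fun x => c * f x + d * g x) w a @[a --> 0^'+]
    --> c * dir_deriv f w + d * dir_deriv g w.
Proof.
move=> fdiff gdiff.
have -> : dir_quotient (fun x => c * f x + d * g x) w =
    (fun a => c * dir_quotient f w a + d * dir_quotient g w a).
  by apply/funext => a; rewrite /dir_quotient; ring.
by apply: cvgD; apply: cvgMl_tmp; [exact: fdiff | exact: gdiff].
Qed.

Lemma dir_differentiable_lincomb f g c d p :
  dir_differentiable f p -> dir_differentiable g p ->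
  dir_differentiable (fun x => c * f x + d * g x) p.
Proof.
move=> fdiff gdiff w; apply/cvg_ex; eexists.
exact: cvg_dir_quotient_lincomb.
Qed.

Lemma dir_deriv_lincomb f g c d p (w : tangent p) :
  dir_differentiable f p -> dir_differentiable g p ->
  dir_deriv (fun x => c * f x + d * g x) w =
  c * dir_deriv f w + d * dir_deriv g w.
Proof.
move=> fdiff gdiff; apply: cvg_lim; first exact: Rhausdorff.
exact: cvg_dir_quotient_lincomb.
Qed.

End DirectionalDerivative.

(** * The multiplier rule for real-valued objectives *)

Section MultiplierRule.
Context {R : realType} {n : nat} {H : hadamard_manifold R n}.

Lemma sum_weighted_dir_deriv_le (I : finType) (E : set H) (lam : I -> R)
    (f : I -> H -> R) (p q : H) :
  (forall i, 0 <= lam i) -> (forall i, convex_at E (f i) p) ->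
  (forall i, dir_differentiable (f i) p) -> E q ->
  \sum_i lam i * dir_deriv (f i) (exp_inv p q) <=
  \sum_i lam i * (f i q - f i p).
Proof.
move=> lam_ge0 fconv fdiff Eq; apply: ler_sum => i _.
by rewrite ler_wpM2l//; apply: dir_deriv_le_of_convex Eq.
Qed.

Lemma weighted_decrease_le0 (I : finType) (lam x y : I -> R) :
  (forall i, 0 < lam i) -> (forall i, x i <= y i) ->
  \sum_i lam i * (x i - y i) <= 0.
Proof.
by move=> lam_gt0 xy; apply: sumr_le0 => i _; rewrite pmulr_rle0// subr_le0.
Qed.

Lemma weighted_decrease_eq (I : finType) (lam x y : I -> R) :
  (forall i, 0 < lam i) -> (forall i, x i <= y i) ->
  0 <= \sum_i lam i * (x i - y i) -> x =1 y.
Proof.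
move=> lam_gt0 xy sum_ge0 i.
have: \sum_j lam j * (y j - x j) = 0.
  apply/eqP; rewrite eq_le sumr_ge0 ?andbT; last first.
    by move=> j _; rewrite pmulr_rge0// subr_ge0.
  rewrite -oppr_ge0 -sumrN.
  by under eq_bigr do rewrite -mulrN opprB.
move/psumr_eq0P => /(_ _ i isT)/eqP; rewrite mulf_eq0 gt_eqF//= subr_eq0.
by move=> sum0; apply/esym/eqP/sum0 => j _; rewrite pmulr_rge0// subr_ge0.
Qed.

(** The scalar core shared by all the cases: [f] and [g] are to be the two
    real functions in terms of which the chosen interval order is
    componentwise. *)
Lemma multiplier_rule_no_descent (I J : finType) (E : set H)
    (lam nu : I -> R) (mu : J -> R) (f g : I -> H -> R) (psi : J -> H -> R)
    (p q : H) :
  (forall i, 0 < lam i) -> (forall i, 0 < nu i) -> (forall u, 0 <= mu u) ->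
  (forall i, convex_at E (f i) p) -> (forall i, dir_differentiable (f i) p) ->
  (forall i, convex_at E (g i) p) -> (forall i, dir_differentiable (g i) p) ->
  (forall u, convex_at E (psi u) p) ->
  (forall u, dir_differentiable (psi u) p) ->
  (forall u, mu u * psi u p = 0) ->
  E q -> (forall u, psi u q <= 0) ->
  0 <= \sum_i lam i * dir_deriv (f i) (exp_inv p q)
     + \sum_i nu i * dir_deriv (g i) (exp_inv p q)
     + \sum_u mu u * dir_deriv (psi u) (exp_inv p q) ->
  (forall i, f i q <= f i p) -> (forall i, g i q <= g i p) ->
  forall i, f i q = f i p /\ g i q = g i p.
Proof.
move=> lam_gt0 nu_gt0 mu_ge0 fconv fdiff gconv gdiff psiconv psidiff slack.
move=> Eq psiq stationary fle gle.
have f_bound := sum_weighted_dir_deriv_le _ _ _ _ _ _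
  (fun i => ltW (lam_gt0 i)) fconv fdiff Eq.
have g_bound := sum_weighted_dir_deriv_le _ _ _ _ _ _
  (fun i => ltW (nu_gt0 i)) gconv gdiff Eq.
have psi_bound := sum_weighted_dir_deriv_le _ _ _ _ _ _
  mu_ge0 psiconv psidiff Eq.
have psi_le0 : \sum_u mu u * (psi u q - psi u p) <= 0.
  by apply: sumr_le0 => u _; rewrite mulrBr slack subr0 mulr_ge0_le0.
have f_le0 := weighted_decrease_le0 _ _ _ _ lam_gt0 fle.
have g_le0 := weighted_decrease_le0 _ _ _ _ nu_gt0 gle.
move=> i; split.
- by apply: (weighted_decrease_eq _ _ _ _ lam_gt0 fle _ i); lra.
- by apply: (weighted_decrease_eq _ _ _ _ nu_gt0 gle _ i); lra.
Qed.

End MultiplierRule.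

(** * Interval orders in terms of real functions *)

Section IntervalOrders.
Context {R : realType}.
Implicit Types T S : cb_interval R.

Lemma cb_interval_eq T S : lo T = lo S -> hi T = hi S -> T = S.
Proof.
case: T S => [a b ab] [c d cd] /= ac bd; move: ab cd; rewrite ac bd => ab cd.
by rewrite (bool_irrelevance ab cd).
Qed.

Lemma cb_interval_eq_CW T S :
  cbi_center T = cbi_center S -> cbi_halfwidth T = cbi_halfwidth S -> T = S.
Proof.
by rewrite /cbi_center /cbi_halfwidth => C W; apply: cb_interval_eq; lra.
Qed.

Context {n : nat} {H : hadamard_manifold R n}.
Implicit Types (E : set H) (f : H -> cb_interval R) (p : H).

Lemma LU_convex_endpoints E f p :
  LU_convex_at E f p -> convex_at E (fL f) p /\ convex_at E (fU f) p.
Proof.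
move=> fconv; split=> q Eq a /andP[a0]; rewrite -subr_ge0 => a1;
  have [] := fconv q Eq a a0 a1; rewrite /fL /fU /=; lra.
Qed.

Lemma CW_convex_center_halfwidth E f p :
  CW_convex_at E f p -> convex_at E (fC f) p /\ convex_at E (fW f) p.
Proof.
move=> fconv; split=> q Eq a /andP[a0]; rewrite -subr_ge0 => a1;
  have [] := fconv q Eq a a0 a1;
  rewrite /cbi_center /cbi_halfwidth /fC /fW /fL /fU /=; lra.
Qed.

Lemma fC_lincomb f : fC f = fun x => 2^-1 * fL f x + 2^-1 * fU f x.
Proof. by apply/funext => x; rewrite /fC mulrDr. Qed.

Lemma fW_lincomb f : fW f = fun x => - 2^-1 * fL f x + 2^-1 * fU f x.
Proof. by apply/funext => x; rewrite /fW; ring. Qed.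

(** Lets CW-convexity be exploited when the multipliers are attached to the
    endpoints. *)
Lemma endpoint_to_CW_dir_deriv (lL lU : R) f p (w : tangent p) :
  weakly_dir_differentiable f p ->
  lL * dir_deriv (fL f) w + lU * dir_deriv (fU f) w =
  (lL + lU) * dir_deriv (fC f) w + (lU - lL) * dir_deriv (fW f) w.
Proof.
move=> [Ldiff Udiff].
by rewrite fC_lincomb fW_lincomb !dir_deriv_lincomb//; field.
Qed.

End IntervalOrders.

(** * Sufficiency for interval-valued objectives *)

Section Sufficiency.
Context {R : realType} {n : nat} {H : hadamard_manifold R n}.
Context {E : set H} {l t : nat}.
Context {phi : 'I_l -> H -> cb_interval R} {psi : 'I_t -> H -> R} {p : H}.
Hypothesis p_feasible : feasible E psi p.
Hypothesis psi_convex : forall u, convex_at E (psi u) p.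
Hypothesis psi_diff : forall u, dir_differentiable (psi u) p.
Hypothesis phi_diff : forall s, weakly_dir_differentiable (phi s) p.
Variable mu : 'I_t -> R.
Hypothesis mu_ge0 : forall u, 0 <= mu u.
Hypothesis slack : forall u, mu u * psi u p = 0.

Lemma LU_sufficiency (lamL lamU : 'I_l -> R) :
  (forall s, LU_convex_at E (phi s) p) ->
  (forall s, 0 < lamL s) -> (forall s, 0 < lamU s) ->
  (forall q, feasible E psi q ->
    0 <= \sum_(s < l) lamL s * dir_deriv (fL (phi s)) (exp_inv p q)
       + \sum_(s < l) lamU s * dir_deriv (fU (phi s)) (exp_inv p q)
       + \sum_(u < t) mu u * dir_deriv (psi u) (exp_inv p q)) ->
  type_I_pareto (feasible E psi) phi p.
Proof.
move=> phi_convex lamL_gt0 lamU_gt0 stationary.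
split=> // -[q [Fq [phi_le [h [_ phi_neq]]]]].
have [Eq psiq] := Fq.
apply: phi_neq.
have [] := @multiplier_rule_no_descent _ _ _ _ _ E lamL lamU mu
    (fun s => fL (phi s)) (fun s => fU (phi s)) psi p q
    lamL_gt0 lamU_gt0 mu_ge0
    (fun s => (LU_convex_endpoints _ _ _ (phi_convex s)).1)
    (fun s => (phi_diff s).1)
    (fun s => (LU_convex_endpoints _ _ _ (phi_convex s)).2)
    (fun s => (phi_diff s).2)
    psi_convex psi_diff slack Eq psiq (stationary q Fq)
    (fun s => (phi_le s).1) (fun s => (phi_le s).2) h.
exact: cb_interval_eq.
Qed.

Lemma CW_sufficiency (lamC lamW : 'I_l -> R) :
  (forall s, CW_convex_at E (phi s) p) ->
  (forall s, 0 < lamC s) -> (forall s, 0 < lamW s) ->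
  (forall q, feasible E psi q ->
    0 <= \sum_(s < l) lamC s * dir_deriv (fC (phi s)) (exp_inv p q)
       + \sum_(s < l) lamW s * dir_deriv (fW (phi s)) (exp_inv p q)
       + \sum_(u < t) mu u * dir_deriv (psi u) (exp_inv p q)) ->
  type_II_pareto (feasible E psi) phi p.
Proof.
move=> phi_convex lamC_gt0 lamW_gt0 stationary.
split=> // -[q [Fq [phi_le [h [_ phi_neq]]]]].
have [Eq psiq] := Fq.
have C_diff s : dir_differentiable (fC (phi s)) p.
  by have [? ?] := phi_diff s; rewrite fC_lincomb;
    apply: dir_differentiable_lincomb.
have W_diff s : dir_differentiable (fW (phi s)) p.
  by have [? ?] := phi_diff s; rewrite fW_lincomb;
    apply: dir_differentiable_lincomb.
apply: phi_neq.
have [] := @multiplier_rule_no_descent _ _ _ _ _ E lamC lamW mu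
    (fun s => fC (phi s)) (fun s => fW (phi s)) psi p q
    lamC_gt0 lamW_gt0 mu_ge0
    (fun s => (CW_convex_center_halfwidth _ _ _ (phi_convex s)).1) C_diff
    (fun s => (CW_convex_center_halfwidth _ _ _ (phi_convex s)).2) W_diff
    psi_convex psi_diff slack Eq psiq (stationary q Fq)
    (fun s => (phi_le s).1) (fun s => (phi_le s).2) h.
exact: cb_interval_eq_CW.
Qed.

End Sufficiency.

Theorem theorem3p2 (R : realType) (n : nat) (H : hadamard_manifold R n)
    (E : set H) (l t : nat)
    (phi : 'I_l -> H -> cb_interval R) (psi : 'I_t -> H -> R) (pbar : H)
    (E_nonempty : E !=set0) (E_open : open E) (E_convex : geodesic_convex E)
    (F_convex : geodesic_convex (feasible E psi))
    (pbar_feasible : feasible E psi pbar)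
    (psi_convex : forall u, convex_at E (psi u) pbar)
    (psi_diff : forall u, dir_differentiable (psi u) pbar) :
  ((forall s, LU_convex_at E (phi s) pbar) ->
   (forall s, weakly_dir_differentiable (phi s) pbar) ->
   (exists (lamL lamU : 'I_l -> R) (mu : 'I_t -> R),
      [/\ forall s, 0 < lamL s /\ 0 < lamU s,
          forall u, 0 <= mu u,
          forall p, feasible E psi p ->
            0 <= \sum_(s < l) lamL s * dir_deriv (fL (phi s)) (exp_inv pbar p)
               + \sum_(s < l) lamU s * dir_deriv (fU (phi s)) (exp_inv pbar p)
               + \sum_(u < t) mu u * dir_deriv (psi u) (exp_inv pbar p) &
          forall u, mu u * psi u pbar = 0]) ->
   type_I_pareto (feasible E psi) phi pbar)
  /\
  ((forall s, CW_convex_at E (phi s) pbar) ->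
   (forall s, weakly_dir_differentiable (phi s) pbar) ->
   (exists (lamC lamW : 'I_l -> R) (mu : 'I_t -> R),
      [/\ forall s, 0 < lamC s /\ 0 < lamW s,
          forall u, 0 <= mu u,
          forall p, feasible E psi p ->
            0 <= \sum_(s < l) lamC s * dir_deriv (fC (phi s)) (exp_inv pbar p)
               + \sum_(s < l) lamW s * dir_deriv (fW (phi s)) (exp_inv pbar p)
               + \sum_(u < t) mu u * dir_deriv (psi u) (exp_inv pbar p) &
          forall u, mu u * psi u pbar = 0]) ->
   type_II_pareto (feasible E psi) phi pbar)
  /\
  ((forall s, CW_convex_at E (phi s) pbar) ->
   (forall s, weakly_dir_differentiable (phi s) pbar) ->
   (exists (lamL lamU : 'I_l -> R) (mu : 'I_t -> R),
      [/\ forall s, 0 < lamL s /\ 0 < lamU s,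
          forall u, 0 <= mu u,
          forall s, lamL s < lamU s,
          forall p, feasible E psi p ->
            0 <= \sum_(s < l) lamL s * dir_deriv (fL (phi s)) (exp_inv pbar p)
               + \sum_(s < l) lamU s * dir_deriv (fU (phi s)) (exp_inv pbar p)
               + \sum_(u < t) mu u * dir_deriv (psi u) (exp_inv pbar p) &
          forall u, mu u * psi u pbar = 0]) ->
   type_II_pareto (feasible E psi) phi pbar).
Proof.
split; [|split].
- move=> phi_convex phi_diff.
  move=> [lamL [lamU [mu [lam_gt0 mu_ge0 stationary slack]]]].
  exact: (LU_sufficiency pbar_feasible psi_convex psi_diff phi_diff mu mu_ge0
    slack lamL lamU phi_convex (fun s => (lam_gt0 s).1)
    (fun s => (lam_gt0 s).2) stationary).
- move=> phi_convex phi_diff.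
  move=> [lamC [lamW [mu [lam_gt0 mu_ge0 stationary slack]]]].
  exact: (CW_sufficiency pbar_feasible psi_convex psi_diff phi_diff mu mu_ge0
    slack lamC lamW phi_convex (fun s => (lam_gt0 s).1)
    (fun s => (lam_gt0 s).2) stationary).
- move=> phi_convex phi_diff.
  move=> [lamL [lamU [mu [lam_gt0 mu_ge0 lamLU stationary slack]]]].
  apply: (CW_sufficiency pbar_feasible psi_convex psi_diff phi_diff mu mu_ge0
    slack (fun s => lamL s + lamU s) (fun s => lamU s - lamL s) phi_convex).
  + by move=> s; have [? ?] := lam_gt0 s; apply: addr_gt0.
  + by move=> s; rewrite subr_gt0.
  + move=> q Fq; have := stationary q Fq; rewrite -!big_split/=.
    by under eq_bigr do rewrite endpoint_to_CW_dir_deriv//.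
Qed.
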